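(* Let $\Lambda=[\mu_1,L_1]\cup[\mu_2,L_2]$ with $0<\mu_1<L_1<\mu_2<L_2$ and $L_1-\mu_1=L_2-\mu_2$; let $\rho=\frac{L_2+\mu_1}{L_2-\mu_1}$, $R=\frac{\mu_2-L_1}{L_2-\mu_1}$, $c=\sqrt{\frac{\rho^2-R^2}{1-R^2}}$ and $\sigma_2^\Lambda(\lambda)=2c^2(1-\lambda/L_1)(1-\lambda/\mu_2)-1$. For $f\in\mathcal{C}_\Lambda$ and $x_0\in\mathbb{R}^d$ define $\omega_0=2$, $x_1=x_0-\frac1{L_1}\nabla f(x_0)$ and for $t\ge1$: $\omega_t=\big(1-\frac{\omega_{t-1}}{4c^2}\big)^{-1}$, $h_t=\omega_t/L_1$ if $t$ is even and $h_t=\omega_t/\mu_2$ if $t$ is odd, $x_{t+1}=x_t-h_t\nabla f(x_t)+(\omega_t-1)(x_t-x_{t-1})$. Then for all $n\ge0$, $$x_{2n}-x_*=\frac{T_n(\sigma_2^\Lambda(H))}{T_n(\sigma_2^\Lambda(0))}(x_0-x_* ),$$ and for each $n\ge1$ the polynomial $T_n(\sigma_2^\Lambda(\cdot))/T_n(\sigma_2^\Lambda(0))$ minimizes $\sup_{\lambda\in\Lambda}|P(\lambda)|$ among all real polynomials $P$ of degree at most $2n$ with $P(0)=1$; consequently no method whose iterates satisfy $x_{t+1}\in x_0+\operatorname{span}\{\nabla f(x_0),\dots,\nabla f(x_t)\}$ has a smaller worst-case rate over $\mathcal{C}_\Lambda$ at iteration $2n$.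
   Context: $\mathcal{C}_\Lambda$ is the class of all quadratic functions $f(x)=\tfrac12(x-x_* )^\top H(x-x_* )+f_*$ on $\mathbb{R}^d$ (any $d\ge1$) with $H$ symmetric and $\mathrm{Sp}(H)\subseteq\Lambda$. $T_n$ is the Chebyshev polynomial of the first kind of degree $n$. The worst-case rate of a method over $\mathcal{C}_\Lambda$ at iteration $t$ is $\sup_{f\in\mathcal{C}_\Lambda,x_0\ne x_*}\|x_t-x_*\|/\|x_0-x_*\|$. *)

(* Defs.v *)
From HB Require Import structures.
From mathcomp Require Import all_boot all_order all_algebra.
From mathcomp Require Import all_classical all_reals ereal.
Set Implicit Arguments. Unset Strict Implicit. Unset Printing Implicit Defensive.
Import Order.TTheory GRing.Theory Num.Theory.
Local Open Scope ring_scope.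
Local Open Scope classical_set_scope.

Section Defs.
Variable R : realType.

Fixpoint cheb_pair (n : nat) : {poly R} * {poly R} :=
  match n with
  | O => (1, 'X)
  | S m => let: (a, b) := cheb_pair m in (b, 2%:P * 'X * b - a)
  end.
Definition chebT (n : nat) : {poly R} := (cheb_pair n).1.

Definition Lambda (mu1 L1 mu2 L2 : R) : set R :=
  [set l | (mu1 <= l <= L1) \/ (mu2 <= l <= L2)].

Definition normv (d : nat) (v : 'cV[R]_d) : R :=
  Num.sqrt (\sum_(i < d) v i ord0 ^+ 2).

(* the quadratic f(x) = 1/2 (x - xs)^T H (x - xs) + fs, and its gradient
   H (x - xs) (H symmetric) *)
Definition quad (d : nat) (H : 'M[R]_d) (xs : 'cV[R]_d) (fs : R)
  (x : 'cV[R]_d) : R :=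
  2^-1 * (((x - xs)^T *m H *m (x - xs)) ord0 ord0) + fs.
Definition grad_quad (d : nat) (H : 'M[R]_d) (xs : 'cV[R]_d)
  (x : 'cV[R]_d) : 'cV[R]_d := H *m (x - xs).

Definition inC (mu1 L1 mu2 L2 : R) (d : nat) (H : 'M[R]_d) : Prop :=
  H^T = H /\ (forall a, eigenvalue H a -> Lambda mu1 L1 mu2 L2 a).

Definition supLambda (mu1 L1 mu2 L2 : R) (P : {poly R}) : \bar R :=
  ereal_sup [set (`|P.[l]|)%:E | l in Lambda mu1 L1 mu2 L2].

Definition rho_par (mu1 L2 : R) : R := (L2 + mu1) / (L2 - mu1).
Definition R_par (mu1 L1 mu2 L2 : R) : R := (mu2 - L1) / (L2 - mu1).
Definition c_par (mu1 L1 mu2 L2 : R) : R :=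
  Num.sqrt ((rho_par mu1 L2 ^+ 2 - R_par mu1 L1 mu2 L2 ^+ 2)
            / (1 - R_par mu1 L1 mu2 L2 ^+ 2)).

Definition sigma2 (mu1 L1 mu2 L2 : R) : {poly R} :=
  (2 * c_par mu1 L1 mu2 L2 ^+ 2)%:P
    * ((1 - L1^-1 *: 'X) * (1 - mu2^-1 *: 'X)) - 1.

Fixpoint omega (mu1 L1 mu2 L2 : R) (t : nat) : R :=
  match t with
  | O => 2
  | S s => (1 - omega mu1 L1 mu2 L2 s / (4 * c_par mu1 L1 mu2 L2 ^+ 2))^-1
  end.

Definition hstep (mu1 L1 mu2 L2 : R) (t : nat) : R :=
  if odd t then omega mu1 L1 mu2 L2 t / mu2 else omega mu1 L1 mu2 L2 t / L1.

(* a first-order method: given the dimension, the function f, its gradient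
   oracle and the starting point x0, it returns the iterates x_t *)
Definition method := forall d : nat,
  ('cV[R]_d.+1 -> R) -> ('cV[R]_d.+1 -> 'cV[R]_d.+1) -> 'cV[R]_d.+1 ->
  nat -> 'cV[R]_d.+1.

(* the proposed method; accel_pair t = (x_t, x_{t+1}) *)
Fixpoint accel_pair (mu1 L1 mu2 L2 : R) (d : nat)
  (g : 'cV[R]_d.+1 -> 'cV[R]_d.+1) (x0 : 'cV[R]_d.+1) (t : nat)
  : 'cV[R]_d.+1 * 'cV[R]_d.+1 :=
  match t with
  | O => (x0, x0 - L1^-1 *: g x0)
  | S s => let: (a, b) := accel_pair mu1 L1 mu2 L2 g x0 s in
      (b, b - hstep mu1 L1 mu2 L2 t *: g b
             + (omega mu1 L1 mu2 L2 t - 1) *: (b - a))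
  end.

Definition accel (mu1 L1 mu2 L2 : R) : method :=
  fun d (f : 'cV[R]_d.+1 -> R) g x0 t => (accel_pair mu1 L1 mu2 L2 g x0 t).1.

Definition krylov (mu1 L1 mu2 L2 : R) (M : method) : Prop :=
  forall (d : nat) (H : 'M[R]_d.+1) (xs : 'cV[R]_d.+1) (fs : R)
         (x0 : 'cV[R]_d.+1),
  inC mu1 L1 mu2 L2 H ->
  let x := M d (quad H xs fs) (grad_quad H xs) x0 in
  x 0%N = x0 /\
  forall t : nat, exists a : 'I_t.+1 -> R,
    x t.+1 = x0 + \sum_(i < t.+1) a i *: grad_quad H xs (x i).

Definition wc_rate (mu1 L1 mu2 L2 : R) (M : method) (t : nat) : \bar R :=
  ereal_sup [set r | exists (d : nat) (H : 'M[R]_d.+1) (xs : 'cV[R]_d.+1)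
                        (fs : R) (x0 : 'cV[R]_d.+1),
     [/\ inC mu1 L1 mu2 L2 H, x0 != xs &
         r = (normv (M d (quad H xs fs) (grad_quad H xs) x0 t - xs)
              / normv (x0 - xs))%:E]].

End Defs.

(* Main.v *)
Require Import Defs.
From HB Require Import structures.
From mathcomp Require Import all_boot all_order all_algebra.
From mathcomp Require Import all_classical all_reals ereal trigo.
From mathcomp Require Import complex ring lra.
Set Implicit Arguments. Unset Strict Implicit.
Unset Printing Implicit Defensive.
Import Order.TTheory GRing.Theory Num.Theory.
Local Open Scope ring_scope.

(** Since [c ^+ 2 = L1 mu2 / ((L1 - mu1) (mu2 - mu1))], the quadratic [sigma]
    maps [mu1, L2] to 1 and [L1, mu2] to -1, so [|sigma| <= 1] on Lambda, and
    [sigma(0) = 2 c^2 - 1 > 1].  With [z^2 = (sigma + 1) / 2], the residual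
    polynomials of the method are proportional to [T_(2n)(z) = T_n(sigma)] at
    even times and to [(1 - x / L1) T_(2n+1)(z) / z] at odd times, and [omega_t]
    is [2 c T_t(c) / T_(t+1)(c)].

    For optimality, [q = T_n(sigma) / T_n(sigma(0))] takes the values
    [(-1)^i / T_n(sigma(0))] at 2n+1 increasing points of Lambda.  Lagrange
    interpolation at 0 on these nodes has coefficients of alternating signs;
    their absolute values, normalised, are weights for which [q] minimises the
    weighted mean square among the [P] with [P(0) = 1].  This bounds the
    supremum of [|P|] from below and, applied to the diagonal matrix of the nodes with
    the square roots of the weights as starting error, also the rate of every
    Krylov method.  The matching upper bound is the spectral theorem. *)

(** The natural numbers provide more roots than the size of the difference allows. This reduces
    polynomial identities to pointwise ones, which [field] can settle. *)
Lemma poly_eq_horner (R : numDomainType) (p q : {poly R}) :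
  (forall x, p.[x] = q.[x]) -> p = q.
Proof.
move=> epq; apply/eqP; rewrite -subr_eq0; apply/eqP.
apply: (@roots_geq_poly_eq0 _ _ [seq i%:R | i <- iota 0 (size (p - q))]).
- by apply/allP => x _; rewrite /root !hornerE epq subrr.
- by rewrite map_inj_uniq ?iota_uniq // => i j /eqP; rewrite eqr_nat => /eqP.
- by rewrite size_map size_iota.
Qed.

(** * Chebyshev polynomials of the first and third kind *)

Section ChebyshevPolynomials.
Variable R : realType.

Lemma chebT0 : chebT R 0 = 1. Proof. by []. Qed.
Lemma chebT1 : chebT R 1 = 'X. Proof. by []. Qed.

Lemma chebTSS n :
  chebT R n.+2 = 2%:P * 'X * chebT R n.+1 - chebT R n.
Proof. by rewrite /chebT /=; case: cheb_pair. Qed.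

(* Chebyshev polynomials of the third kind: T_(2n+1)(z) = z V_n(2 z^2 - 1),
   the odd counterpart of T_(2n)(z) = T_n(2 z^2 - 1). *)
Fixpoint chebV (n : nat) : {poly R} :=
  if n is m.+1 then 2%:P * chebT R n - chebV m else 1.

(** With the recursion defining [chebV], this advances T and V alternately, as the method alternates
    odd and even steps. *)
Lemma chebTS_chebV n :
  chebT R n.+1 = ('X + 1) * chebV n - chebT R n.
Proof.
elim: n => [|n IH]; first by rewrite chebT0 chebT1 /=; ring.
have eT : chebT R n = ('X + 1) * chebV n - chebT R n.+1 by rewrite IH; ring.
by rewrite chebTSS /= eT; ring.
Qed.

Lemma horner_chebTS n (s : R) :
  (chebT R n.+1).[s] = (s + 1) * (chebV n).[s] - (chebT R n).[s].
Proof. by rewrite chebTS_chebV !hornerE. Qed.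

Lemma horner_chebVS n (s : R) :
  (chebV n.+1).[s] = 2 * (chebT R n.+1).[s] - (chebV n).[s].
Proof. by rewrite /= !hornerE. Qed.

(** The comparison a <= b carries the induction: the next a is (s + 1) b - a >= s b > 0, and the
    next difference is s b - a >= (s - 1) b > 0. *)
Lemma cheb_gt0 n (s : R) : 1 < s ->
  0 < (chebT R n).[s] <= (chebV n).[s].
Proof.
move=> s1; elim: n => [|n]; first by rewrite !hornerE ltr01 lexx.
rewrite horner_chebVS horner_chebTS => /andP[a0 ab].
set a := (chebT R n).[s] in a0 ab *; set b := (chebV n).[s] in ab *.
apply/andP; split; nra.
Qed.

Lemma chebT_gt0 n (s : R) : 1 < s -> 0 < (chebT R n).[s].
Proof. by move=> /(cheb_gt0 n) /andP[]. Qed.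

Lemma chebV_gt0 n (s : R) : 1 < s -> 0 < (chebV n).[s].
Proof. by move=> /(cheb_gt0 n) /andP[]; apply: lt_le_trans. Qed.

End ChebyshevPolynomials.

(** * Errors as polynomials in the Hessian *)

Section MatrixPolynomials.
Variable R : realType.

Lemma residual_step d (H : 'M[R]_d.+1) (xs a b v : 'cV[R]_d.+1) (p q : {poly R})
    (h w : R) :
  a - xs = horner_mx H p *m v -> b - xs = horner_mx H q *m v ->
  b - h *: grad_quad H xs b + w *: (b - a) - xs
    = horner_mx H (q - h *: ('X * q) + w *: (q - p)) *m v.
Proof.
move=> ea eb; rewrite /grad_quad.
have -> : b - a = (b - xs) - (a - xs) by rewrite opprB addrA subrK.
rewrite addrAC (addrAC b) ea eb.
rewrite rmorphD rmorphB /= !horner_mxZ rmorphM rmorphB /= horner_mx_X.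
rewrite !(mulmxDl, mulNmx, mulmxBl) -!scalemxAl -mulmxBl.
by rewrite -mulmxE mulmxA mulmxBl.
Qed.

Lemma horner_mx_comp d (H : 'M[R]_d.+1) (p q : {poly R}) :
  horner_mx H (p \Po q) = horner_mx (horner_mx H q) p.
Proof.
elim/poly_ind: p => [|p a IH]; first by rewrite comp_poly0 !rmorph0.
rewrite comp_polyD comp_polyM comp_polyX comp_polyC !rmorphD !rmorphM /= IH.
by rewrite horner_mx_X !horner_mx_C.
Qed.

End MatrixPolynomials.

(** * Residual polynomials of the accelerated method *)

Section TwoIntervals.
Context {R : realType} {mu1 L1 mu2 L2 : R}.
Hypotheses (mu1_gt0 : 0 < mu1) (mu1L1 : mu1 < L1) (L1mu2 : L1 < mu2)
  (mu2L2 : mu2 < L2) (eq_length : L1 - mu1 = L2 - mu2).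

Local Notation sigma := (sigma2 mu1 L1 mu2 L2).
Local Notation c := (c_par mu1 L1 mu2 L2).
Local Notation om := (omega mu1 L1 mu2 L2).
Local Notation s0 := (sigma.[0]).

(** Equal lengths give L2 + mu1 = L1 + mu2. Up to the common factor (L2 - mu1)^-2, the differences
    of squares in [c_par] then factor as 4 L1 mu2 and 4 (L1 - mu1) (mu2 - mu1). *)
Lemma c_par_sqr : c ^+ 2 = L1 * mu2 / ((L1 - mu1) * (mu2 - mu1)).
Proof.
move: mu1_gt0 mu1L1 L1mu2 mu2L2 eq_length => h1 h2 h3 h4 h5.
rewrite /c_par /rho_par /R_par.
have eL2 : L2 = L1 - mu1 + mu2 by rewrite eq_length; ring.
have pos : 0 < L1 * mu2 / ((L1 - mu1) * (mu2 - mu1)).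
  by rewrite divr_gt0 // !mulr_gt0 //; lra.
set e := _ / _.
suff ee : e = L1 * mu2 / ((L1 - mu1) * (mu2 - mu1)).
  by rewrite ee sqr_sqrtr // ltW.
rewrite /e eL2; field.
do ?[apply/andP; split]; apply: lt0r_neq0; nra.
Qed.

Lemma horner_sigma2 x :
  sigma.[x] = 2 * c ^+ 2 * ((1 - L1^-1 * x) * (1 - mu2^-1 * x)) - 1.
Proof.
by rewrite /sigma2 !(hornerD, hornerN, hornerM, hornerC, hornerZ, hornerX).
Qed.

Lemma sigma2E x :
  sigma.[x] = 2 * (L1 - x) * (mu2 - x) / ((L1 - mu1) * (mu2 - mu1)) - 1.
Proof.
move: mu1_gt0 mu1L1 L1mu2 mu2L2 eq_length => h1 h2 h3 h4 h5.
rewrite horner_sigma2 c_par_sqr; field.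
do ?[apply/andP; split]; apply: lt0r_neq0; lra.
Qed.

Lemma sigma0_par : sigma.[0] = 2 * c ^+ 2 - 1.
Proof. by rewrite horner_sigma2; ring. Qed.

Lemma sigma0_gt1 : 1 < sigma.[0].
Proof.
move: mu1_gt0 mu1L1 L1mu2 mu2L2 eq_length => h1 h2 h3 h4 h5.
rewrite sigma0_par c_par_sqr.
suff : 1 < L1 * mu2 / ((L1 - mu1) * (mu2 - mu1)) by lra.
rewrite ltr_pdivlMr ?mulr_gt0 //; nra.
Qed.

Local Notation a_ n := ((chebT R n).[s0]).
Local Notation b_ n := ((chebV R n).[s0]).

Let a_neq0 n : a_ n != 0. Proof. exact/lt0r_neq0/chebT_gt0/sigma0_gt1. Qed.
Let b_neq0 n : b_ n != 0. Proof. exact/lt0r_neq0/chebV_gt0/sigma0_gt1. Qed.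
Let L1_neq0 : L1 != 0. Proof. exact/lt0r_neq0/(lt_trans mu1_gt0). Qed.
Let mu2_neq0 : mu2 != 0.
Proof. exact/lt0r_neq0/(lt_trans (lt_trans mu1_gt0 mu1L1)). Qed.
Let s0_neq : 1 + s0 != 0.
Proof. by apply: lt0r_neq0; have := sigma0_gt1; lra. Qed.

(** As s0 = 2 c^2 - 1, one has T_(2n)(c) = a_n and T_(2n+1)(c) = c b_n, so both formulas are the
    ratio 2 c T_t(c) / T_(t+1)(c). Each parity follows from the previous one by one recurrence
    step. *)
Lemma omega_even_odd n :
  om (2 * n) = 2 * a_ n / b_ n /\
  om (2 * n).+1 = (1 + s0) * b_ n / a_ n.+1.
Proof.
have e4 : 4 * c ^+ 2 = 2 * (1 + s0) by rewrite sigma0_par; ring.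
have odd_of k : om (2 * k) = 2 * a_ k / b_ k ->
    om (2 * k).+1 = (1 + s0) * b_ k / a_ k.+1.
  move=> /= ->; rewrite e4.
  have eb : a_ k.+1 = (s0 + 1) * b_ k - a_ k by rewrite horner_chebTS.
  have := a_neq0 k.+1; rewrite eb => nz; field.
  by rewrite b_neq0 s0_neq nz.
have even_of k : om (2 * k).+1 = (1 + s0) * b_ k / a_ k.+1 ->
    om (2 * k.+1) = 2 * a_ k.+1 / b_ k.+1.
  rewrite mulnS add2n => ek; rewrite [LHS]/= -/(om (2 * k).+1) ek e4.
  have eb : b_ k.+1 = 2 * a_ k.+1 - b_ k by rewrite horner_chebVS.
  have := b_neq0 k.+1; rewrite eb => nz; field.
  by rewrite a_neq0 s0_neq nz.
suff e : om (2 * n) = 2 * a_ n / b_ n by split => //; exact: odd_of.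
elim: n => [|n IH]; last exact/even_of/odd_of.
by rewrite muln0 /= !hornerE; field.
Qed.

Definition even_residual n : {poly R} := (a_ n)^-1 *: (chebT R n \Po sigma).
(** V_n(sigma) is T_(2n+1)(z) / z. The linear factor is the first gradient step and equals 1 at
    0. *)
Definition odd_residual n : {poly R} :=
  (b_ n)^-1 *: ((1 - L1^-1 *: 'X) * (chebV R n \Po sigma)).

Lemma horner_even_residual n x :
  (even_residual n).[x] = (a_ n)^-1 * (chebT R n).[sigma.[x]].
Proof. by rewrite hornerZ horner_comp. Qed.

Lemma horner_odd_residual n x :
  (odd_residual n).[x]
    = (b_ n)^-1 * ((1 - L1^-1 * x) * (chebV R n).[sigma.[x]]).
Proof. by rewrite hornerZ hornerM horner_comp !hornerE. Qed.

Lemma horner_residual_step (p q : {poly R}) (h w x : R) :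
  (q - h *: ('X * q) + w *: (q - p)).[x]
    = q.[x] - h * (x * q.[x]) + w * (q.[x] - p.[x]).
Proof. by rewrite !hornerE; ring. Qed.

(** The step omega / mu2 multiplies the odd residual by omega (1 - x / mu2). Joined to its factor 1
    - x / L1 this gives (sigma + 1) / (s0 + 1), and what remains is [horner_chebTS] at sigma(x) and
    at s0. *)
Lemma even_residualS n :
  even_residual n.+1 = odd_residual n
    - hstep mu1 L1 mu2 L2 (2 * n).+1 *: ('X * odd_residual n)
    + (om (2 * n).+1 - 1) *: (odd_residual n - even_residual n).
Proof.
have [_ eo] := omega_even_odd n.
rewrite /hstep (_ : odd _ = true); last by rewrite /= oddM.
rewrite eo; apply: poly_eq_horner => x.
rewrite horner_residual_step !horner_even_residual horner_odd_residual.
have eab : a_ n.+1 = (s0 + 1) * b_ n - a_ n by rewrite horner_chebTS.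
rewrite (horner_chebTS n sigma.[x]).
have es : sigma.[x] = (s0 + 1) * (1 - L1^-1 * x) * (1 - mu2^-1 * x) - 1.
  by rewrite sigma0_par [LHS]horner_sigma2; ring.
rewrite es.
have := a_neq0 n.+1; rewrite eab => nz; field.
by rewrite ?nz ?a_neq0 ?b_neq0 ?L1_neq0 ?mu2_neq0.
Qed.

(** Here the step omega / L1 supplies the factor 1 - x / L1, and the recursion of V does the
    rest. *)
Lemma odd_residualS n :
  odd_residual n.+1 = even_residual n.+1
    - hstep mu1 L1 mu2 L2 (2 * n).+2 *: ('X * even_residual n.+1)
    + (om (2 * n).+2 - 1) *: (even_residual n.+1 - odd_residual n).
Proof.
have := omega_even_odd n.+1; rewrite mulnS add2n => -[ee _].
rewrite /hstep (_ : odd _ = false); last by rewrite /= negbK oddM.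
rewrite ee; apply: poly_eq_horner => x.
rewrite horner_residual_step !horner_odd_residual horner_even_residual.
rewrite (horner_chebVS n sigma.[x]).
have eab : b_ n.+1 = 2 * a_ n.+1 - b_ n by rewrite horner_chebVS.
have := b_neq0 n.+1; rewrite eab => nz; field.
by rewrite ?nz ?a_neq0 ?b_neq0 ?L1_neq0 ?mu2_neq0.
Qed.

Lemma accel_pair_residual d (H : 'M[R]_d.+1) (xs x0 : 'cV[R]_d.+1) n :
  let x := accel_pair mu1 L1 mu2 L2 (grad_quad H xs) x0 (2 * n) in
  x.1 - xs = horner_mx H (even_residual n) *m (x0 - xs) /\
  x.2 - xs = horner_mx H (odd_residual n) *m (x0 - xs).
Proof.
elim: n => [|n].
  rewrite muln0 /= /even_residual /odd_residual /= !hornerE invr1 !scale1r.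
  rewrite !comp_polyC !mulr1 rmorph1 mul1mx; split=> //.
  rewrite rmorphB /= rmorph1 horner_mxZ horner_mx_X mulmxBl mul1mx -scalemxAl.
  by rewrite addrAC.
rewrite mulnS add2n /=; case: accel_pair => x y /= [ex ey].
have e1 := residual_step (hstep mu1 L1 mu2 L2 (2 * n).+1)
  (om (2 * n).+1 - 1) ex ey.
rewrite -even_residualS in e1; split=> //.
by rewrite (residual_step _ _ ey e1) -odd_residualS.
Qed.

End TwoIntervals.

(** * Lagrange interpolation at 0 and the weights of an alternation *)

Section Certificate.
Variables (R : realFieldType) (N : nat) (x : 'I_N -> R).

Lemma lagrange_interpolation (P : {poly R}) (y : R) :
  injective x -> (size P <= N)%N ->
  P.[y] = \sum_(i < N)
    P.[x i] * \prod_(j < N | j != i) ((y - x j) / (x i - x j)).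
Proof.
move=> x_inj sP.
pose l i : {poly R} :=
  \prod_(j < N | j != i) ((x i - x j)^-1 *: ('X - (x j)%:P)).
have hl i z : (l i).[z] = \prod_(j < N | j != i) ((z - x j) / (x i - x j)).
  by rewrite horner_prod; apply: eq_bigr => j _; rewrite !hornerE mulrC.
have size_l i : (size (l i) <= N)%N.
  rewrite /l scaler_prod; apply: leq_trans (size_scale_leq _ _) _.
  rewrite -big_enum size_prod_XsubC -cardE cardC1 card_ord.
  by rewrite prednK // (leq_ltn_trans _ (ltn_ord i)).
pose Q := \sum_(i < N) P.[x i] *: l i.
suff eP : P = Q.
  by rewrite {1}eP horner_sum; apply: eq_bigr => i _; rewrite hornerZ hl.
apply/eqP; rewrite -subr_eq0; apply/eqP.
(* [P - Q] has size at most N and vanishes at the N distinct nodes. *)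
apply: (@roots_geq_poly_eq0 _ _ (codom x)).
- apply/allP => _ /codomP[i ->]; rewrite /root hornerD hornerN horner_sum.
  rewrite (bigD1 i) //= big1 ?addr0 => [|j ji]; rewrite hornerZ hl.
    rewrite big1 ?mulr1 ?subrr // => j ji.
    by rewrite divff // subr_eq0 (inj_eq x_inj) eq_sym.
  by rewrite (bigD1 i) 1?eq_sym //= subrr !mul0r mulr0.
- by rewrite map_inj_uniq ?enum_uniq.
- rewrite size_map size_enum_ord (leq_trans (size_polyD _ _)) // size_polyN.
  rewrite geq_max sP /= (leq_trans (size_sum _ _ _)) //.
  by apply/bigmax_leqP => i _; rewrite (leq_trans (size_scale_leq _ _)).
Qed.

Hypothesis x_gt0 : forall i, 0 < x i.
Hypothesis x_incr : forall i j : 'I_N, (i < j)%N -> x i < x j.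

Let x_inj : injective x.
Proof.
move=> i j eij; apply/val_inj; case: (ltngtP i j) => // /x_incr.
  by rewrite eij ltxx.
by rewrite eij ltxx.
Qed.

(* The factors with [j < i] are the negative ones. *)
Lemma lagrange0_sign (i : 'I_N) :
  0 < (-1) ^+ i * \prod_(j < N | j != i) ((0 - x j) / (x i - x j)).
Proof.
(* The sign is spread over the factors: exactly i indices j lie below i. *)
have -> : (-1) ^+ i = \prod_(j < N | j != i) (-1) ^+ (j < i)%N :> R.
  rewrite prodrXr; congr (_ ^+ _).
  rewrite -[LHS]card_ord -sum1_card.
  rewrite (big_ord_widen N (fun=> 1%N) (ltnW (ltn_ord i))).
  rewrite big_mkcond [RHS]big_mkcond; apply: eq_bigr => j _ /=.
  by case: ltngtP => [|| /ord_inj ->] //=; case: eqP => // ->; rewrite ?ltnn.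
rewrite -big_split /=; apply: prodr_gt0 => j ji.
have xj := x_gt0 j; have xi := x_gt0 i.
case: (ltngtP j i) => [/x_incr h|/x_incr h|/ord_inj eij].
- by rewrite expr1 mulN1r -mulNr opprB subr0 divr_gt0 // subr_gt0.
- by rewrite expr0 mul1r sub0r -opprB invrN mulrNN divr_gt0 // subr_gt0.
- by rewrite eij eqxx in ji.
Qed.

(** Take M times the absolute Lagrange coefficients at 0. Interpolating q gives total mass 1;
    interpolating P shows that the signed values (-1)^i P(x_i) have mean M. Their variance is
    nonnegative, so their second moment is at least M^2. *)
Lemma equioscillation_weights (q : {poly R}) (M : R) :
  0 < M -> (size q <= N)%N -> q.[0] = 1 ->
  (forall i, q.[x i] = (-1) ^+ i * M) ->
  exists w : 'I_N -> R, [/\ forall i, 0 < w i, \sum_i w i = 1 &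
    forall P : {poly R}, (size P <= N)%N -> P.[0] = 1 ->
      M ^+ 2 <= \sum_i w i * P.[x i] ^+ 2].
Proof.
move=> M0 sq q0 qx.
pose l i := \prod_(j < N | j != i) ((0 - x j) / (x i - x j)).
pose w (i : 'I_N) := M * ((-1) ^+ i * l i); exists w.
have w_gt0 i : 0 < w i by rewrite mulr_gt0 ?lagrange0_sign.
have w1 : \sum_i w i = 1.
  rewrite -[RHS]q0 (lagrange_interpolation _ x_inj sq); apply: eq_bigr => i _.
  by rewrite qx /w mulrA (mulrC M).
split=> // P sP P0.
have eM : \sum_i w i * ((-1) ^+ i * P.[x i]) = M.
  transitivity (M * P.[0]); last by rewrite P0 mulr1.
  rewrite (lagrange_interpolation _ x_inj sP) big_distrr /=.
  apply: eq_bigr => i _; rewrite -/(l i) /w.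
  transitivity (M * ((-1) ^+ i * (-1) ^+ i) * (P.[x i] * l i)).
    by move: ((-1) ^+ i : R) (l i) => e li; ring.
  by rewrite -expr2 sqrr_sign mulr1.
have : 0 <= \sum_i w i * ((-1) ^+ i * P.[x i] - M) ^+ 2.
  by apply: sumr_ge0 => i _; rewrite mulr_ge0 ?sqr_ge0 // ltW.
suff -> : \sum_i w i * ((-1) ^+ i * P.[x i] - M) ^+ 2 =
  \sum_i w i * P.[x i] ^+ 2 - M ^+ 2 by rewrite subr_ge0.
clearbody w; transitivity (\sum_i (w i * P.[x i] ^+ 2
   - 2 * M * (w i * ((-1) ^+ i * P.[x i])) + M ^+ 2 * w i)).
  apply: eq_bigr => i _; rewrite sqrrB exprMn sqrr_sign mul1r.
  by move: ((-1) ^+ i : R) => e; ring.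
rewrite big_split sumrB /= -!big_distrr /= eM w1; ring.
Qed.

End Certificate.

(** * Chebyshev polynomials on [-1, 1] through the cosine *)

Section ChebyshevTrigonometry.
Variable R : realType.
Implicit Types (n : nat) (s t : R).

Lemma chebT_cos n t : (chebT R n).[cos t] = cos (n%:R * t).
Proof.
suff : (chebT R n).[cos t] = cos (n%:R * t) /\
       (chebT R n.+1).[cos t] = cos (n.+1%:R * t) by case.
elim: n => [|n [IH1 IH2]].
  by rewrite chebT0 chebT1 !hornerE ?mul0r ?mul1r cos0.
split=> //; rewrite chebTSS !hornerE IH1 IH2.
have -> : n.+2%:R * t = n.+1%:R * t + t by rewrite -[n.+2]addn1 natrD; ring.
have -> : n%:R * t = n.+1%:R * t - t by rewrite -[n.+1]addn1 natrD; ring.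
by rewrite cosB cosD; ring.
Qed.

Lemma chebT_le1 n s : `|s| <= 1 -> `|(chebT R n).[s]| <= 1.
Proof.
rewrite ler_norml => hs.
by rewrite -[s]acosK ?in_itv //= chebT_cos cos_max.
Qed.

Lemma cos_natpi n : cos (n%:R * pi) = (-1) ^+ n :> R.
Proof.
elim: n => [|n IH]; first by rewrite mul0r cos0.
by rewrite -addn1 natrD mulrDl mul1r cosDpi IH exprD expr1 mulrN1.
Qed.

Lemma size_chebT n : (size (chebT R n) <= n.+1)%N.
Proof.
suff : (size (chebT R n) <= n.+1)%N && (size (chebT R n.+1) <= n.+2)%N.
  by case/andP.
elim: n => [|n /andP[IH1 IH2]].
  by rewrite chebT0 chebT1 size_poly1 size_polyX.
rewrite IH2 chebTSS (leq_trans (size_polyD _ _)) // size_polyN geq_max.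
apply/andP; split; last exact: leq_trans IH1 (leqW (leqnSn _)).
rewrite -mulrA mul_polyC (leq_trans (size_scale_leq _ _)) // mulrC.
by rewrite (leq_trans (size_polyMleq _ _)) // size_polyX addn2.
Qed.

End ChebyshevTrigonometry.

(** * Norm of a polynomial in a symmetric matrix *)

Section SpectralBound.
Local Open Scope sesquilinear_scope.
Variable R : realType.
Local Notation C := R[i]%C.
Local Notation toC := (real_complex R).

Let sqnorm d (v : 'cV[C]_d) : C := \sum_i `|v i 0| ^+ 2.

Let sqnormE d (v : 'cV[C]_d) : sqnorm v = (v^t* *m v) 0 0.
Proof. by rewrite mxE; apply: eq_bigr => i _; rewrite !mxE normCK mulrC. Qed.

Let sqnorm_unitary d (P : 'M[C]_d) v :
  P \is unitarymx -> sqnorm (P *m v) = sqnorm v.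
Proof.
move=> uP; rewrite !sqnormE trmx_mul map_mxM /= mulmxA.
by rewrite -(mulmxA _ _ P) -invmx_unitary // mulVmx ?unitarymx_unit // mulmx1.
Qed.

Let sqnorm_real d (v : 'cV[R]_d) : sqnorm (map_mx toC v) = toC (normv v ^+ 2).
Proof.
rewrite /normv sqr_sqrtr ?sumr_ge0 // => [|i _]; last exact: sqr_ge0.
rewrite rmorph_sum; apply: eq_bigr => i _ /=.
by rewrite mxE rmorphXn real_normK // complex_real.
Qed.

(** Over the complex numbers H is hermitian, hence unitarily diagonalisable. Unitary maps preserve
    the norm, and in the eigenbasis each coordinate is scaled by the value of p at an eigenvalue. *)
Lemma normv_horner_mx_le d (H : 'M[R]_d.+1) (p : {poly R}) (M : R) v :
  H^T = H -> 0 <= M -> (forall a, eigenvalue H a -> `|p.[a]| <= M) ->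
  normv (horner_mx H p *m v) <= M * normv v.
Proof.
move=> symH M0 pM.
pose A := map_mx toC H.
have realA : A \is a mxOver Num.real.
  by apply/mxOverP => i j; rewrite mxE complex_real.
have hermA : A \is hermsymmx.
  apply: realsym_hermsym realA; apply/is_hermitianmxP.
  by rewrite expr0 scale1r map_mx_id //; apply/matrixP => i j;
    rewrite /A -{1}symH !mxE.
have uP := spectral_unitarymx A.
have realD := hermitian_spectral_diag_real hermA.
have /orthomx_spectralP := hermitian_normalmx hermA.
move: (spectralmx A) (spectral_diag A) uP realD => P D uP realD eA.
have unitP := unitarymx_unit uP.
(* The bound on p concerns real eigenvalues of [H]. Row i of [P] is a left eigenvector of [A] for
   [D 0 i], and the characteristic polynomial brings this real value back to [H]. *)
have eigD i : exists2 a, eigenvalue H a & D 0 i = toC a.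
  have /complex_realP[a ea] : D 0 i \is Num.real by exact: (mxOverP realD).
  exists a => //; rewrite eigenvalue_root_char -(fmorph_root toC) map_char_poly.
  rewrite -/A -eigenvalue_root_char; apply/eigenvalueP.
  exists (row i P); last first.
    apply: contraTneq unitP => rP; rewrite unitmxE unitfE negbK.
    rewrite (expand_det_row _ i) big1 // => j _.
    by move/rowP: rP => /(_ j); rewrite !mxE => ->; rewrite mul0r.
  rewrite -row_mul eA mulmxA mulmxA mulmxV // mul1mx row_mul.
  by rewrite row_diag_mx -scalemxAl -rowE ea.
have hA : map_mx toC (horner_mx H p) =
    invmx P *m diag_mx (map_mx (horner (map_poly toC p)) D) *m P.
  have -> : map_mx toC (horner_mx H p) = horner_mx A (map_poly toC p).
    exact: map_horner_mx.
  by rewrite {1}eA (horner_mx_uconjC _ _ unitP) horner_mx_diag.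
rewrite -(@ler_pXn2r _ 2) ?nnegrE ?sqrtr_ge0 //; last first.
  by rewrite mulr_ge0 ?sqrtr_ge0.
rewrite -lecR -sqnorm_real exprMn rmorphM /= -sqnorm_real map_mxM hA.
have uPi : invmx P \is unitarymx by rewrite invmx_unitary // trmxC_unitary.
rewrite -!mulmxA (sqnorm_unitary _ uPi) -(sqnorm_unitary (map_mx toC v) uP).
set w := P *m _.
rewrite /sqnorm big_distrr /=; apply: ler_sum => i _.
rewrite mul_diag_mx !mxE normrM exprMn ler_wpM2r ?sqr_ge0 //.
have [a Ha ->] := eigD i.
rewrite horner_map real_normK ?complex_real // -!rmorphXn lecR.
by rewrite -real_normK ?num_real // ler_pXn2r ?nnegrE // pM.
Qed.

End SpectralBound.

(** * The alternation points in the two intervals *)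

Section EquioscillationNodes.
Context {R : realType} {mu1 L1 mu2 L2 : R}.
Hypotheses (mu1_gt0 : 0 < mu1) (mu1L1 : mu1 < L1) (L1mu2 : L1 < mu2)
  (mu2L2 : mu2 < L2) (eq_length : L1 - mu1 = L2 - mu2).

Local Notation sigma := (sigma2 mu1 L1 mu2 L2).

(** The product (L1 - x) (mu2 - x) is nonnegative off the gap; on the hull it is largest at both
    ends mu1 and L2, where equal lengths make its values agree. *)
Lemma sigma2_le1 x : Lambda mu1 L1 mu2 L2 x -> `|sigma.[x]| <= 1.
Proof.
move: mu1_gt0 mu1L1 L1mu2 mu2L2 eq_length => h1 h2 h3 h4 h5.
rewrite /Lambda /= => hx; rewrite sigma2E //.
have D0 : 0 < (L1 - mu1) * (mu2 - mu1) by rewrite mulr_gt0; lra.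
set e := _ / _.
suff /andP[] : 0 <= e <= 2 by move=> ? ?; rewrite ler_norml; lra.
rewrite /e divr_ge0 ?(ltW D0) ?ler_pdivrMr //=.
  by case: hx => /andP[? ?]; nra.
by case: hx => /andP[? ?]; nra.
Qed.

(* The solutions of sigma(x) = y are the points at distance [radius y] from the
   common midpoint (L1 + mu2) / 2 of the gap and of the hull of Lambda. *)
Definition radius (y : R) : R :=
  Num.sqrt (((mu2 - L1) / 2) ^+ 2 + (L1 - mu1) * (mu2 - mu1) * ((1 + y) / 2)).

Local Notation center := ((L1 + mu2) / 2).

Lemma radius_sqr y : -1 <= y ->
  radius y ^+ 2 =
    ((mu2 - L1) / 2) ^+ 2 + (L1 - mu1) * (mu2 - mu1) * ((1 + y) / 2).
Proof.
move: mu1L1 L1mu2 => h2 h3 hy; rewrite /radius sqr_sqrtr //.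
by rewrite addr_ge0 ?sqr_ge0 // !mulr_ge0 //; lra.
Qed.

Lemma sigma2_radius y x : -1 <= y -> (x - center) ^+ 2 = radius y ^+ 2 ->
  sigma.[x] = y.
Proof.
move=> hy; rewrite radius_sqr // sigma2E // => ex.
move: mu1_gt0 mu1L1 L1mu2 => h1 h2 h3.
have D0 : 0 < (L1 - mu1) * (mu2 - mu1) by rewrite mulr_gt0; lra.
have -> : 2 * (L1 - x) * (mu2 - x) = (L1 - mu1) * (mu2 - mu1) * (1 + y).
  transitivity (2 * ((x - center) ^+ 2 - ((mu2 - L1) / 2) ^+ 2)).
    by field.
  by rewrite ex; field.
rewrite mulrC mulKf ?lt0r_neq0 //; ring.
Qed.

(** The bounds are the radii for y = -1, reaching the ends of the gap, and for y = 1, reaching the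
    ends of the hull. *)
Lemma radius_bounds y : -1 <= y <= 1 ->
  (mu2 - L1) / 2 <= radius y <= center - mu1.
Proof.
move: mu1_gt0 mu1L1 L1mu2 => h1 h2 h3 /andP[y1 y2].
have := radius_sqr y1; have : 0 <= radius y by rewrite sqrtr_ge0.
have D0 : 0 < (L1 - mu1) * (mu2 - mu1) by rewrite mulr_gt0; lra.
move: (radius y) => r r0 er; apply/andP; split.
  rewrite -(@ler_pXn2r _ 2) ?nnegrE //; last by lra.
  by rewrite er lerDl mulr_ge0 ?(ltW D0) //; lra.
rewrite -(@ler_pXn2r _ 2) ?nnegrE //; last by lra.
rewrite er -subr_ge0.
have -> : (center - mu1) ^+ 2 - (((mu2 - L1) / 2) ^+ 2
   + (L1 - mu1) * (mu2 - mu1) * ((1 + y) / 2))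
   = (L1 - mu1) * (mu2 - mu1) * ((1 - y) / 2) by field.
by rewrite mulr_ge0 ?(ltW D0) //; lra.
Qed.

Lemma radius_incr y z : -1 <= y -> y < z -> radius y < radius z.
Proof.
move: mu1_gt0 mu1L1 L1mu2 => h1 h2 h3 y1 yz.
rewrite -(@ltr_pXn2r _ 2) ?nnegrE ?sqrtr_ge0 // !radius_sqr //; last by lra.
by rewrite ltrD2l ltr_pM2l ?mulr_gt0 //; lra.
Qed.

Variable n : nat.
Hypothesis n_gt0 : (0 < n)%N.

Definition cheb_extremum (k : nat) : R := cos (k%:R * pi / n%:R).

(** From left to right, sigma descends from 1 at mu1 to -1 at L1, then climbs back to 1 at L2. The
    point mu2 is left out, since sigma is -1 there as at L1 and the signs would not alternate. *)
Definition cheb_node (k : nat) : R :=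
  if (k <= n)%N then center - radius (cheb_extremum k)
  else center + radius (cheb_extremum (2 * n - k)).

Let nR_gt0 : 0 < n%:R :> R. Proof. by rewrite ltr0n. Qed.

Let extremum_bounds k : -1 <= cheb_extremum k <= 1.
Proof. by rewrite cos_geN1 cos_le1. Qed.

Lemma cheb_extremum_decr i j : (i < j <= n)%N ->
  cheb_extremum j < cheb_extremum i.
Proof.
case/andP=> ij jn; have p0 := pi_gt0 R.
have bnd k : (k <= n)%N -> (k%:R * pi / n%:R : R) \in `[0, pi]%R.
  move=> kn; rewrite in_itv /= divr_ge0 ?mulr_ge0 ?ler0n ?(ltW p0) //=.
  by rewrite ler_pdivrMr // mulrC ler_wpM2l ?(ltW p0) // ler_nat.
rewrite ltr_cos ?bnd // ?(leq_trans (ltnW ij)) //.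
by rewrite ltr_pM2r ?invr_gt0 // ltr_pM2r // ltr_nat.
Qed.

Lemma chebT_extremum k : (chebT R n).[cheb_extremum k] = (-1) ^+ k.
Proof.
rewrite /cheb_extremum chebT_cos mulrC divfK ?cos_natpi // lt0r_neq0 //.
Qed.

Lemma cheb_node_incr i j : (i < j <= 2 * n)%N -> cheb_node i < cheb_node j.
Proof.
case/andP=> ij j2n; rewrite /cheb_node.
have bnd k := extremum_bounds k.
case: (leqP j n) => jn.
  rewrite (leq_trans (ltnW ij)) // ltrD2l ltrN2 radius_incr //.
    by case/andP: (bnd j).
  by rewrite cheb_extremum_decr ?ij.
case: (leqP i n) => hi.
  (* The gap separates the two nodes. *)
  move: L1mu2 (radius_bounds (bnd i)) (radius_bounds (bnd (2 * n - j)%N)).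
  by move=> ? /andP[? _] /andP[? _]; lra.
rewrite ltrD2l radius_incr //; first by case/andP: (bnd (2 * n - i)%N).
rewrite cheb_extremum_decr // ltn_sub2l ?(leq_trans ij) //=.
by rewrite leq_subLR mul2n -addnn leq_add2r ltnW.
Qed.

Lemma cheb_node_Lambda k : Lambda mu1 L1 mu2 L2 (cheb_node k).
Proof.
move: mu2L2 eq_length => h4 h5.
rewrite /Lambda /cheb_node /=; case: leqP => _; [left|right].
  by have /andP[? ?] := radius_bounds (extremum_bounds k); lra.
by have /andP[? ?] := radius_bounds (extremum_bounds (2 * n - k)); lra.
Qed.

Lemma cheb_node_gt0 k : 0 < cheb_node k.
Proof.
move: mu1_gt0 mu1L1 L1mu2 => h1 h2 h3.
by case: (cheb_node_Lambda k) => /andP[? _]; lra.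
Qed.

Lemma chebT_node k : (k <= 2 * n)%N ->
  (chebT R n).[sigma.[cheb_node k]] = (-1) ^+ k.
Proof.
move=> k2n; rewrite /cheb_node; case: leqP => hk.
  rewrite (@sigma2_radius (cheb_extremum k)) ?chebT_extremum //.
    by case/andP: (extremum_bounds k).
  by rewrite addrAC subrr sub0r sqrrN.
rewrite (@sigma2_radius (cheb_extremum (2 * n - k))) ?chebT_extremum //.
(* [2 * n - k] and [k] have the same parity. *)
- by rewrite -signr_odd oddB // oddM signr_odd.
- by case/andP: (extremum_bounds (2 * n - k)).
- by rewrite addrAC subrr add0r.
Qed.

End EquioscillationNodes.

(** * Residual polynomials of an arbitrary Krylov method *)

Lemma krylov_residual (R : realType) d (H : 'M[R]_d.+1) (xs : 'cV[R]_d.+1)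
    (x0 : 'cV[R]_d.+1) (x : nat -> 'cV[R]_d.+1) :
  x 0%N = x0 ->
  (forall t, exists a : 'I_t.+1 -> R,
     x t.+1 = x0 + \sum_(i < t.+1) a i *: grad_quad H xs (x i)) ->
  forall t, exists P : {poly R}, [/\ (size P <= t.+1)%N, P.[0] = 1 &
    x t - xs = horner_mx H P *m (x0 - xs)].
Proof.
move=> ex0 hx; elim/ltn_ind => -[|t] IH.
  exists 1; split; rewrite ?size_poly1 ?hornerC //.
  by rewrite rmorph1 mul1mx ex0.
have [a ea] := hx t.
have /boolp.choice[P hP] : forall i : 'I_t.+1, exists P : {poly R},
    [/\ (size P <= i.+1)%N, P.[0] = 1 &
        x i - xs = horner_mx H P *m (x0 - xs)] by move=> i; exact: IH.
(* A gradient is [H] times an earlier error, so it contributes X times an earlier residual: the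
   degree bound rises by one and the value at 0 stays 1. *)
exists (1 + \sum_(i < t.+1) a i *: ('X * P i)); split.
- rewrite (leq_trans (size_polyD _ _)) // geq_max size_poly1 /=.
  rewrite (leq_trans (size_sum _ _ _)) //; apply/bigmax_leqP => i _.
  rewrite (leq_trans (size_scale_leq _ _)) //.
  rewrite (leq_trans (size_polyMleq _ _)) // size_polyX /=.
  by have [sP _ _] := hP i; rewrite ltnS (leq_trans sP).
- rewrite hornerD hornerC horner_sum big1 ?addr0 // => i _.
  by rewrite hornerZ hornerM hornerX mul0r mulr0.
- rewrite ea addrAC rmorphD /= rmorph1 mulmxDl mul1mx; congr (_ + _).
  rewrite rmorph_sum mulmx_suml; apply: eq_bigr => i _ /=.
  have [_ _ eP] := hP i.
  rewrite horner_mxZ rmorphM /= horner_mx_X -scalemxAl -mulmxE -mulmxA.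
  by rewrite /grad_quad eP.
Qed.

(** * Minimax property and worst-case rates *)

Section Optimality.
Context {R : realType} {mu1 L1 mu2 L2 : R}.
Hypotheses (mu1_gt0 : 0 < mu1) (mu1L1 : mu1 < L1) (L1mu2 : L1 < mu2)
  (mu2L2 : mu2 < L2) (eq_length : L1 - mu1 = L2 - mu2).
Variable n : nat.

Local Notation sigma := (sigma2 mu1 L1 mu2 L2).
Local Notation q := (@even_residual R mu1 L1 mu2 L2 n).
Local Notation rate := ((chebT R n).[sigma.[0]]^-1).
Local Notation node := (@cheb_node R mu1 L1 mu2 n).

Let rate_gt0 : 0 < rate.
Proof. by rewrite invr_gt0 chebT_gt0 // sigma0_gt1. Qed.

Lemma even_residual_le x : Lambda mu1 L1 mu2 L2 x -> `|q.[x]| <= rate.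
Proof.
move=> hx; rewrite horner_even_residual normrM gtr0_norm // ger_pMr //.
by rewrite chebT_le1 // sigma2_le1.
Qed.

Lemma size_even_residual : (size q <= (2 * n).+1)%N.
Proof.
rewrite /even_residual (leq_trans (size_scale_leq _ _)) //.
rewrite (leq_trans (size_comp_poly_leq _ _)) // ltnS mulnC.
have s3 : (size sigma <= 3)%N.
  rewrite /sigma2 (leq_trans (size_polyD _ _)) // size_polyN geq_max size_poly1.
  have lin (a : R) : (size (1 - a *: 'X : {poly R})%R <= 2)%N.
    rewrite (leq_trans (size_polyD _ _)) // size_polyN geq_max size_poly1 /=.
    by rewrite (leq_trans (size_scale_leq _ _)) // size_polyX.
  rewrite andbT mul_polyC (leq_trans (size_scale_leq _ _)) //.
  rewrite (leq_trans (size_polyMleq _ _)) //.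
  by rewrite -subn1 leq_subLR (leq_add (lin _) (lin _)).
by apply: leq_mul; rewrite -subn1 leq_subLR ?(leq_trans s3) // size_chebT.
Qed.

Lemma minimax_weights : (0 < n)%N ->
  exists w : 'I_(2 * n).+1 -> R, [/\ forall i, 0 < w i, \sum_i w i = 1 &
    forall P : {poly R}, (size P <= (2 * n).+1)%N -> P.[0] = 1 ->
      rate ^+ 2 <= \sum_i w i * P.[node i] ^+ 2].
Proof.
move=> n_gt0;
  apply: (@equioscillation_weights _ _ (fun i => node i) _ _ q) => //.
- by move=> i; exact: (cheb_node_gt0 _ _ _ mu2L2).
- by move=> i j ij; apply: cheb_node_incr => //; rewrite ij -ltnS /=.
- exact: size_even_residual.
- by rewrite horner_even_residual mulVf // lt0r_neq0 // -invr_gt0.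
- move=> i; rewrite horner_even_residual mulrC chebT_node //.
  by rewrite -ltnS.
Qed.

Lemma supLambda_even_residual_min (P : {poly R}) : (0 < n)%N ->
  (size P <= (2 * n).+1)%N -> P.[0] = 1 ->
  (supLambda mu1 L1 mu2 L2 q <= supLambda mu1 L1 mu2 L2 P)%E.
Proof.
move=> n_gt0 sP P0; have [w [w0 w1 wP]] := minimax_weights n_gt0.
apply: (@le_trans _ _ rate%:E).
  apply: ge_ereal_sup => _ [x hx <-]; rewrite lee_fin; exact: even_residual_le.
(* If |P| were below the rate at every node, so would be its weighted root mean square. *)
have [i hi] : exists i : 'I_(2 * n).+1, rate <= `|P.[node i]|.
  apply/not_existsP => hlt; have := wP P sP P0; apply/negP; rewrite -ltNge.
  rewrite -[ltRHS]mul1r -w1 big_distrl /=; apply: ltr_sum => // [|i _].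
    by apply/hasP; exists ord0; rewrite ?mem_index_enum.
  rewrite ltr_pM2l // -real_normK ?num_real //.
  rewrite ltr_pXn2r ?nnegrE ?(ltW rate_gt0) //.
  by rewrite ltNge; apply/negP/hlt.
apply: (@le_trans _ _ (`|P.[node i]|)%:E); first by rewrite lee_fin.
by apply: ereal_sup_ubound; exists (node i) => //; exact: cheb_node_Lambda.
Qed.

Lemma wc_rate_accel_le :
  (wc_rate mu1 L1 mu2 L2 (accel mu1 L1 mu2 L2) (2 * n) <= rate%:E)%E.
Proof.
apply: ge_ereal_sup => _ [d [H [xs [fs [x0 [[symH spH] x0xs ->]]]]]].
rewrite lee_fin /accel.
have [-> _] :=
  accel_pair_residual mu1_gt0 mu1L1 L1mu2 mu2L2 eq_length H xs x0 n.
rewrite ler_pdivrMr.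
  apply: normv_horner_mx_le => //; first exact: ltW.
  by move=> a /spH; exact: even_residual_le.
rewrite sqrtr_gt0 lt0r sumr_ge0 ?andbT => [|i _]; last exact: sqr_ge0.
apply: contraNneq x0xs => /psumr_eq0P e.
rewrite -subr_eq0; apply/eqP/colP => i; rewrite [RHS]mxE.
by apply/eqP; rewrite -sqrf_eq0 e // => j _; exact: sqr_ge0.
Qed.

Lemma wc_rate_krylov_ge (M : method R) : (0 < n)%N ->
  krylov mu1 L1 mu2 L2 M -> (rate%:E <= wc_rate mu1 L1 mu2 L2 M (2 * n))%E.
Proof.
move=> n_gt0 hM; have [w [w0 w1 wP]] := minimax_weights n_gt0.
(* With minimiser 0, [x0] is itself the initial error. It has norm 1, and a residual P leaves the
   squared error sum of w_i P(node_i)^2. *)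
pose D := \row_(i < (2 * n).+1) node i; pose H := diag_mx D.
pose x0 := \col_(i < (2 * n).+1) Num.sqrt (w i).
have inH : inC mu1 L1 mu2 L2 H.
  split=> [|a /eigenvalueP[v]]; first exact: tr_diag_mx.
  rewrite /H mul_mx_diag => /rowP ev; case/rV0Pn => i vi.
  have := ev i; rewrite !mxE mulrC => /(mulIf vi) <-; exact: cheb_node_Lambda.
have [x00 hx] := hM _ H 0 0 x0 inH.
have [P [sP P0 eP]] := krylov_residual x00 hx (2 * n).
have nx0 : normv (x0 - 0) = 1.
  rewrite subr0 /normv (eq_bigr w) ?w1 ?sqrtr1 // => i _.
  by rewrite mxE sqr_sqrtr // ltW.
set r :=
  normv (M _ (quad H 0 0) (grad_quad H 0) x0 (2 * n)%N - 0) / normv (x0 - 0).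
apply: (@le_trans _ _ r%:E); last first.
  (* The index [2 * n] stands for dimension 2n + 1, one coordinate per node. *)
  apply: ereal_sup_ubound; exists (2 * n)%N, H, 0, 0, x0; split=> //.
  apply: contra_eq_neq nx0 => ->; rewrite /normv subrr.
  rewrite big1 ?sqrtr0 1?eq_sym ?oner_eq0 // => i _.
  by rewrite mxE expr0n.
rewrite lee_fin /r nx0 divr1 eP /H horner_mx_diag mul_diag_mx.
rewrite -[leLHS]gtr0_norm // -sqrtr_sqr ler_sqrt; last first.
  by apply: sumr_ge0 => i _; exact: sqr_ge0.
apply: le_trans (wP P sP P0) _; apply: ler_sum => i _.
by rewrite !mxE subr0 exprMn sqr_sqrtr ?(ltW (w0 i)) // mulrC.
Qed.

End Optimality.

Theorem mainTheorem12 (R : realType) (mu1 L1 mu2 L2 : R) :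
  0 < mu1 -> mu1 < L1 -> L1 < mu2 -> mu2 < L2 -> L1 - mu1 = L2 - mu2 ->
  let sigma := sigma2 mu1 L1 mu2 L2 in
  let q := fun n : nat =>
    ((chebT R n).[sigma.[0]])^-1 *: ((chebT R n) \Po sigma) in
  (forall (n d : nat) (H : 'M[R]_d.+1) (xs x0 : 'cV[R]_d.+1),
     inC mu1 L1 mu2 L2 H ->
     (accel_pair mu1 L1 mu2 L2 (grad_quad H xs) x0 (2 * n)%N).1 - xs
     = ((chebT R n).[sigma.[0]])^-1 *:
         horner_mx (horner_mx H sigma) (chebT R n) *m (x0 - xs))
  /\ (forall n : nat, (0 < n)%N ->
       forall P : {poly R}, (size P <= (2 * n).+1)%N -> P.[0] = 1 ->
       (supLambda mu1 L1 mu2 L2 (q n) <= supLambda mu1 L1 mu2 L2 P)%E)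
  /\ (forall n : nat, (0 < n)%N ->
       forall M : method R, krylov mu1 L1 mu2 L2 M ->
       (wc_rate mu1 L1 mu2 L2 (accel mu1 L1 mu2 L2) (2 * n)
          <= wc_rate mu1 L1 mu2 L2 M (2 * n))%E).
Proof.
move=> h1 h2 h3 h4 h5 sigma q; split; last split.
- move=> n d H xs x0 _.
  have [-> _] := accel_pair_residual h1 h2 h3 h4 h5 H xs x0 n.
  by rewrite /even_residual horner_mxZ horner_mx_comp.
- by move=> n n_gt0 P sP P0; apply: supLambda_even_residual_min.
- move=> n n_gt0 M hM; apply: le_trans (wc_rate_accel_le h1 h2 h3 h4 h5 n) _.
  exact: wc_rate_krylov_ge.
Qed.
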